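(* Let $X$ be a Tychonoff space which is a $k_\omega$-space and let $X=\bigcup_{n\in\mathbb{N}} C_n$ be a $k_\omega$-decomposition of $X$. Then the free topological vector space $\mathbb{V}(X)$ is a $k_\omega$-space and $\mathbb{V}(X)=\bigcup_{n\in\mathbb{N}} \mathrm{sp}_n(C_n)$ is a $k_\omega$-decomposition of $\mathbb{V}(X)$.
   Context: All vector spaces are over $\mathbb{R}$; all topological spaces are Tychonoff (so topological vector spaces are Hausdorff). The free topological vector space over a Tychonoff space $X$ is a topological vector space $\mathbb{V}(X)$ together with a continuous map $i:X\to\mathbb{V}(X)$ such that for every continuous map $f$ from $X$ to a topological vector space $E$ there is a unique continuous linear operator $\bar f:\mathbb{V}(X)\to E$ with $f=\bar f\circ i$. The map $i$ is an embedding, $X$ is identified with $i(X)$, and $X$ is then a vector space basis of $\mathbb{V}(X)$. For a subset $A$ of a vector space and $n\in\mathbb{N}$, $\mathrm{sp}_n(A):=\{\lambda_1x_1+\cdots+\lambda_nx_n:\ \lambda_i\in[-n,n],\ x_i\in A,\ i=1,\dots,n\}$. A space $X$ is a $k_\omega$-space if it is the inductive limit of an increasing sequence $C_1\subseteq C_2\subseteq\cdots$ of compact subsets, i.e. $X=\bigcup_n C_n$ and $U\subseteq X$ is open if and only if $U\cap C_n$ is open in $C_n$ for every $n$; in this case $X=\bigcup_n C_n$ is called a $k_\omega$-decomposition of $X$. *)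

(* Defs.v *)
From HB Require Import structures.
From mathcomp Require Import all_boot all_order all_algebra.
From mathcomp Require Import all_classical all_reals all_analysis.
Import Order.TTheory GRing.Theory Num.Theory.
Import numFieldNormedType.Exports.

Set Implicit Arguments.
Unset Strict Implicit.
Unset Printing Implicit Defensive.

Local Open Scope classical_set_scope.
Local Open Scope ring_scope.

Definition tychonoff_space (T : topologicalType) : Prop :=
  hausdorff_space T /\ completely_regular_space T.

(* The sequence C_1, C_2, ... is represented by C : nat -> set T with C n
   standing for C_(n+1). *)
Definition k_omega_decomposition (T : topologicalType) (C : nat -> set T) :
    Prop :=
  [/\ forall n, compact (C n),
      forall n, C n `<=` C n.+1,
      \bigcup_n C n = [set: T]
    & forall U : set T,
        open U <-> forall n, open (U `&` C n : set (subspace (C n)))].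

Definition k_omega_space (T : topologicalType) : Prop :=
  exists C : nat -> set T, k_omega_decomposition C.

(* The library's tvsType requires local convexity, which the universal property
   below must not: it has to range over all Hausdorff topological vector spaces,
   so topologicalLmodType is used. *)
Definition is_free_tvs (R : realType) (X : topologicalType)
    (V : topologicalLmodType R) (i : X -> V) : Prop :=
  [/\ hausdorff_space V,
      continuous i
    & forall (E : topologicalLmodType R) (f : X -> E),
        hausdorff_space E -> continuous f ->
        exists! g : V -> E, [/\ linear g, continuous g & f = g \o i]].

Definition sp (R : realType) (V : lmodType R) (n : nat) (A : set V) : set V :=
  [set v | exists (l : 'I_n -> R) (x : 'I_n -> V),
     [/\ forall j, - n%:R <= l j <= n%:R,
         forall j, A (x j)
       & v = \sum_(j < n) l j *: x j]].

(* Main.v *)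
Require Import Defs.
From HB Require Import structures.
From mathcomp Require Import all_boot all_order all_algebra.
From mathcomp Require Import all_classical all_reals all_analysis.
Import Order.TTheory GRing.Theory Num.Theory.
Import numFieldNormedType.Exports.

Set Implicit Arguments.
Unset Strict Implicit.
Unset Printing Implicit Defensive.

Local Open Scope classical_set_scope.
Local Open Scope ring_scope.

(** The sets [K n = sp n.+1 (i @` C n)] are compact, increase with [n], and are
    absorbed by one another under addition and under multiplication by bounded
    scalars.  Hence their union is a linear subspace [W] of [V], which can be
    given the k_omega topology of the [K n]: a subset of [W] is open when its
    trace on every [K n] is relatively open there.  The universal property of
    [V] forces [W] to be [V], with its topology.

    The main point is that [W] is a topological vector space.  Addition and
    scaling are continuous on each product [K n `*` K n] or
    [[-n, n] `*` K n], so what has to be shown is that the product of two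
    k_omega topologies is again determined by the products of the compact
    layers ([coherent_open_box]).  Given a set [O] whose traces on the products
    of layers are relatively open and a point of [O], a box around the point is
    grown layer by layer: at each step the closure of the current box, cut down
    to the current layers, is a compact box inside [O], and
    [compact_box_thickening] fits an open box around it whose closure stays in
    [O] on the next layers.  The increasing union of these boxes is the
    neighbourhood sought.

    The inclusion [W -> V] is continuous and injective, so [W] is Hausdorff.
    The map [i], viewed as a map [j : X -> W], is continuous because it is so on
    each [C n] and [X] has the k_omega topology of the [C n].  So [j] extends to
    a continuous linear [g : V -> W].  Composing [g] with the inclusion gives a
    continuous linear endomorphism of [V] that fixes [i]; by uniqueness it is
    the identity.  Thus every vector lies in some [K n], and a set with
    relatively open traces is the preimage under [g] of an open subset of [W],
    hence open in [V]. *)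

(** * Boxes around compact boxes *)

(** If every closed neighbourhood of [x] met [K], then by compactness the traces
    of these neighbourhoods on [K] would cluster at some point of [K], which a
    Hausdorff space identifies with [x]. *)
Lemma compact_separate_point (T : topologicalType) (K : set T) (x : T) :
  hausdorff_space T -> compact K -> ~ K x ->
  exists A, [/\ open A, K `<=` A & ~ closure A x].
Proof.
move=> hT cK nKx.
have [[M [Mx KM]]|noM] := pselect (exists M, nbhs x M /\ K `&` closure M = set0).
  exists (~` closure M); split.
  - exact/closed_openC/closed_closure.
  - by move=> y Ky cMy; rewrite -[False]/(set0 y) -KM.
  - move=> /(_ M Mx) [y [ncMy My]]; exact/ncMy/subset_closure.
pose F := filter_from (nbhs x) (fun M => K `&` closure M).
have FF : ProperFilter F.
  apply: filter_from_proper => [|M Mx]; last first.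
    by apply/set0P/eqP => KM; apply: noM; exists M.
  apply: filter_from_filter => [|M N Mx Nx]; first by exists setT; exact: filterT.
  exists (M `&` N); first exact: filterI.
  by move=> y [Ky cMN]; split; split=> //; apply: closureS cMN => z [].
have [|p [Kp Fp]] := cK F FF; first by exists setT; [exact: filterT|move=> y []].
suff : p = x by move=> px; rewrite px in Kp.
apply/esym/hT => M N Mx Np.
have [y [[_ cMy] Ny]] := Fp _ N° (ex_intro2 _ _ M Mx (fun=> id)) (nbhs_interior Np).
have [z [Mz Nz]] := cMy _ Ny.
by exists z.
Qed.

(** Otherwise the closures of all open boxes around [P `*` Q] reach
    [(K `*` L) `\` G], and compactness of [K `*` L] gives a point common to all
    these closures and outside of [G].  By [compact_separate_point] its
    coordinates lie in [P] and [Q], against [P `*` Q `<=` G]. *)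
Lemma compact_box_thickening (T S : topologicalType) (K P : set T)
    (L Q : set S) (G : set (T * S)) :
  hausdorff_space T -> hausdorff_space S ->
  compact K -> compact L -> compact P -> compact Q ->
  open G -> P `*` Q `<=` G ->
  exists A B, [/\ open A, open B, P `<=` A, Q `<=` B &
    (closure A `&` K) `*` (closure B `&` L) `<=` G].
Proof.
move=> hT hS cK cL cP cQ oG PQG.
apply: contrapT => noAB.
pose bad (AB : set T * set S) :=
  ((closure AB.1 `&` K) `*` (closure AB.2 `&` L)) `\` G.
pose D := [set AB : set T * set S |
  [/\ open AB.1, open AB.2, P `<=` AB.1 & Q `<=` AB.2]].
have FF : ProperFilter (filter_from D bad).
  apply: filter_from_proper => [|[A B] [oA oB PA QB]]; last first.
    apply/set0P/eqP => bad0; apply: noAB; exists A, B; split=> // z ABz.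
    by apply: contrapT => nGz; rewrite -[False]/(set0 z) -bad0.
  apply: filter_from_filter; first by exists (setT, setT); split=> //; exact: openT.
  move=> [A B] [A' B'] [oA oB PA QB] [oA' oB' PA' QB'] /=.
  exists (A `&` A', B `&` B').
    by split=> /=; [exact: openI|exact: openI|rewrite subsetI|rewrite subsetI].
  move=> z [[[cA Kz] [cB Lz]] nGz].
  by split; split=> //; split; split=> //;
    [move: cA|move: cB|move: cA|move: cB]; apply: closureS => y [].
have [|[x y] [[/= Kx Ly] clxy]] := compact_setX cK cL FF.
  exists (setT, setT); first by split=> //; exact: openT.
  by move=> z [[[_ ?] [_ ?]] _].
have [Gxy|nGxy] := pselect (G (x, y)).
  have [|z [[_ nGz] Gz]] // := clxy (bad (setT, setT)) G _ (open_nbhs_nbhs (conj oG Gxy)).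
  by exists (setT, setT) => //; split=> //; exact: openT.
apply: nGxy; apply: PQG; split=> /=; apply: contrapT.
  move=> /(compact_separate_point hT cP) [A [oA PA]]; apply=> N Nx.
  have [||z [[[[+ _] _] _] [Nz _]]] := clxy (bad (A, setT)) (N° `*` setT).
  - by exists (A, setT) => //; split=> //; exact: openT.
  - by exists (N°, setT) => //; split; [exact: nbhs_interior|exact: filterT].
  - by move=> /(_ _ Nz) [t [At Nt]]; exists t.
move=> /(compact_separate_point hS cQ) [B [oB QB]]; apply=> N Ny.
have [||z [[[_ [+ _]] _] [_ Nz]]] := clxy (bad (setT, B)) (setT `*` N°).
- by exists (setT, B) => //; split=> //; exact: openT.
- by exists (setT, N°) => //; split; [exact: filterT|exact: nbhs_interior].
- by move=> /(_ _ Nz) [t [Bt Nt]]; exists t.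
Qed.

(** * The topology coherent with a sequence of compact sets *)

(** The sets whose traces on [\bigcup_n K n] are open in the inductive limit of
    the subspaces [K n]; the part of [U] outside of that union is
    unconstrained. *)
Definition coherent_open (T : topologicalType) (K : nat -> set T) (U : set T) :=
  forall n, open (U : set (subspace (K n))).

Lemma increasing_seq_subset (T : Type) (K : nat -> set T) :
  (forall n, K n `<=` K n.+1) -> forall m n, (m <= n)%N -> K m `<=` K n.
Proof.
move=> Kinc m; elim=> [|n IHn]; first by rewrite leqn0 => /eqP ->.
by rewrite leq_eqVlt => /orP[/eqP -> //|/IHn KmKn]; exact: subset_trans (Kinc n).
Qed.

(** The traces [K (n + N) `&` A n] increase with [n], so on [K m] only the [A n]
    with [n >= m] count, and there the constraint [K (n + N)] is vacuous: the
    union agrees on [K m] with the open set [\bigcup_n A (n + m)]. *)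
Lemma coherent_open_bigcup_trace (T : topologicalType) (K A : nat -> set T)
    (N : nat) :
  (forall n, K n `<=` K n.+1) -> (forall n, open (A n)) ->
  (forall n, K (n + N)%N `&` A n `<=` A n.+1) ->
  coherent_open K (\bigcup_n (K (n + N)%N `&` A n)).
Proof.
move=> Kinc oA KA m; apply/open_subspaceP.
exists (\bigcup_n A (n + m)%N); first by apply: bigcup_open => n _; exact: oA.
have KAinc j n : K (n + N)%N `&` A n `<=` A (n + j)%N.
  elim: j => [|j IHj] x [Kx Ax]; first by rewrite addn0.
  rewrite addnS; apply: KA; split; last exact: IHj.
  by apply: increasing_seq_subset Kx => //; rewrite leq_add2r leq_addr.
apply/seteqP; split=> x [[n _ Ax] Kx]; split=> //.
- exists (n + m)%N => //; split=> //.
  by apply: increasing_seq_subset Kx => //; rewrite -addnA addnCA leq_addr.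
- by exists n => //; exact: KAinc.
Qed.

(** In other words a product of two k_omega spaces is a k_omega space; the spaces
    are given here as unions of compact subsets of Hausdorff spaces. *)
Lemma coherent_open_box (T S : topologicalType) (K : nat -> set T)
    (L : nat -> set S) (O : set (T * S)) (N : nat) (a : T) (b : S) :
  hausdorff_space T -> hausdorff_space S ->
  (forall n, compact (K n)) -> (forall n, compact (L n)) ->
  (forall n, K n `<=` K n.+1) -> (forall n, L n `<=` L n.+1) ->
  coherent_open (fun n => K n `*` L n) O ->
  K N a -> L N b -> O (a, b) ->
  exists U V, [/\ coherent_open K U, coherent_open L V, U a, V b &
    U `*` V `<=` O].
Proof.
move=> hT hS cK cL Kinc Linc oO KNa LNb Oab.
have relO n : exists G : set (T * S), open G /\
    G `&` (K n `*` L n) = O `&` (K n `*` L n).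
  by have /open_subspaceP[G oG GO] := oO n; exists G.
(* The invariant of the recursion bounds the closures, not just the sets, so
   that the next step can start from a compact box.  Indices are shifted by
   [N] to have [(a, b)] in the first pair of layers. *)
pose good n (AB : set T * set S) := [/\ open AB.1, open AB.2 &
  (closure AB.1 `&` K (n + N)%N) `*` (closure AB.2 `&` L (n + N)%N) `<=` O].
have thicken n (P : set T) (Q : set S) : compact P -> compact Q ->
    P `<=` K (n + N)%N -> Q `<=` L (n + N)%N -> P `*` Q `<=` O ->
    exists AB, [/\ good n AB, P `<=` AB.1 & Q `<=` AB.2].
  move=> cP cQ PK QL PQO.
  have [G [oG GO]] := relO (n + N)%N.
  have PQG : P `*` Q `<=` G.
    move=> z [Pz Qz]; suff [] : (G `&` (K (n + N)%N `*` L (n + N)%N)) z by [].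
    by rewrite GO; split; [exact: PQO|split; [exact: PK|exact: QL]].
  have [A [B [oA oB PA QB ABG]]] :=
    compact_box_thickening hT hS (cK (n + N)%N) (cL (n + N)%N) cP cQ oG PQG.
  exists (A, B); split=> //; split=> //= z ABz.
  suff [] : (O `&` (K (n + N)%N `*` L (n + N)%N)) z by [].
  by rewrite -GO; split; [exact: ABG|case: ABz => [[_ ?] [_ ?]]].
have next nAB : exists AB', good nAB.1 nAB.2 ->
    [/\ good nAB.1.+1 AB', closure nAB.2.1 `&` K (nAB.1 + N)%N `<=` AB'.1 &
        closure nAB.2.2 `&` L (nAB.1 + N)%N `<=` AB'.2].
  case: nAB => n [A B] /=.
  have [[/= oA oB ABO]|] := pselect (good n (A, B)); last by exists (A, B).
  have [||||AB' [gAB' AA' BB']] := thicken n.+1 (closure A `&` K (n + N)%N)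
    (closure B `&` L (n + N)%N) _ _ _ _ ABO; last by exists AB'.
  - by rewrite setIC; apply: compact_closedI => //; exact: closed_closure.
  - by rewrite setIC; apply: compact_closedI => //; exact: closed_closure.
  - by rewrite addSn => x [_ /Kinc].
  - by rewrite addSn => x [_ /Linc].
have [step stepP] := choice next.
have [|||||AB0 [gAB0 aA0 bB0]] := thicken 0%N [set a] [set b].
- exact: compact_set1.
- exact: compact_set1.
- by move=> _ ->.
- by move=> _ ->.
- by move=> [x y] [/= -> ->].
pose AB := fix AB n := if n is m.+1 then step (m, AB m) else AB0.
have gAB n : good n (AB n) by elim: n => [//|n /(stepP (n, AB n)) []].
have [oA oB] : (forall n, open (AB n).1) /\ (forall n, open (AB n).2).
  by split=> n; have [] := gAB n.
have KA n : K (n + N)%N `&` (AB n).1 `<=` (AB n.+1).1.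
  have [_ KA _] := stepP (n, AB n) (gAB n).
  by move=> x [Kx Ax]; apply: KA; split=> //; exact: subset_closure.
have LB n : L (n + N)%N `&` (AB n).2 `<=` (AB n.+1).2.
  have [_ _ LB] := stepP (n, AB n) (gAB n).
  by move=> x [Lx Bx]; apply: LB; split=> //; exact: subset_closure.
exists (\bigcup_n (K (n + N)%N `&` (AB n).1)),
  (\bigcup_n (L (n + N)%N `&` (AB n).2)); split.
- exact: coherent_open_bigcup_trace.
- exact: coherent_open_bigcup_trace.
- by exists 0%N => //; split=> //; exact: aA0.
- by exists 0%N => //; split=> //; exact: bB0.
- move=> [x y] [/= [n _ KAx] [m _ LBy]].
  have KAle j : (K (n + j + N)%N `&` (AB (n + j)%N).1) x.
    elim: j => [|j IHj]; first by rewrite addn0.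
    by rewrite addnS; split; [rewrite addSn; apply: Kinc; case: IHj|exact: KA].
  have LBle j : (L (m + j + N)%N `&` (AB (m + j)%N).2) y.
    elim: j => [|j IHj]; first by rewrite addn0.
    by rewrite addnS; split; [rewrite addSn; apply: Linc; case: IHj|exact: LB].
  have [_ _ ABO] := gAB (n + m)%N; apply: ABO; split=> /=.
    by have [] := KAle m; split=> //; exact: subset_closure.
  by rewrite addnC; have [] := LBle n; split=> //; exact: subset_closure.
Qed.

Lemma coherent_open_preimage (T S : topologicalType) (K : nat -> set T)
    (L : nat -> set S) (f : T -> S) (U : set S) :
  continuous f -> (forall n, exists m, K n `<=` f @^-1` L m) ->
  coherent_open L U -> coherent_open K (f @^-1` U).
Proof.
move=> cf KL oU n; have [m KLm] := KL n.
have /open_subspaceP[G oG GU] := oU m.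
apply/open_subspaceP; exists (f @^-1` G); first by move/continuousP: cf; apply.
apply/seteqP; split=> x [fx Kx]; split=> //.
  by have [] : (U `&` L m) (f x) by rewrite -GU; split=> //; exact: KLm.
by have [] : (G `&` L m) (f x) by rewrite GU; split=> //; exact: KLm.
Qed.

Lemma open_coherent_open (T : topologicalType) (K : nat -> set T) (U : set T) :
  open U -> coherent_open K U.
Proof. by move=> oU n; apply/open_subspaceP; exists U. Qed.

Definition segments (R : realType) (n : nat) : set R^o :=
  `[- n%:R, n%:R]%classic.

Lemma segmentsE (R : realType) (n : nat) (a : R^o) :
  segments n a <-> `|a| <= n%:R.
Proof. by rewrite /segments /= in_itv /= ler_norml. Qed.

Lemma coherent_open_segments (R : realType) (U : set R^o) :
  coherent_open (@segments R) U -> open U.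
Proof.
move=> oU; rewrite openE => x Ux.
pose n := (Num.truncn `|x|).+1.
have /open_subspaceP[G oG GU] := oU n.
have xn : `|x| < n%:R by rewrite /n; exact: truncnS_gt.
have /andP[nx xn'] : - n%:R < x < n%:R by rewrite -ltr_norml.
have : nbhs x (G `&` `]- n%:R, n%:R[%classic).
  apply: filterI; last by apply: near_in_itvoo; rewrite in_itv /= nx.
  apply: open_nbhs_nbhs; split=> //.
  have [] // : (G `&` segments n) x.
  by rewrite GU; split=> //; rewrite /segments /= in_itv /= !ltW.
apply: filterS => y [Gy]; rewrite /= in_itv /= => /andP[ny yn].
have [] // : (U `&` segments n) y.
by rewrite -GU; split=> //; rewrite /segments /= in_itv /= !ltW.
Qed.

(** * The span of a compact filtration as a topological vector space *)

(** The conditions that make [\bigcup_n layer n] a linear subspace on which the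
    coherent topology is a Hausdorff vector topology.  The layers themselves are
    not linear: a single later layer only has to absorb the sums and the bounded
    multiples of the vectors of a given layer. *)
Record compact_filtration (R : realType) (V : topologicalLmodType R) :=
  CompactFiltration {
    layer :> nat -> set V;
    ambient_hausdorff : hausdorff_space V;
    layer_compact : forall n, compact (layer n);
    layer_increasing : forall n, layer n `<=` layer n.+1;
    layer_zero : exists n, layer n 0;
    layer_add : forall n, exists m, forall x y,
      layer n x -> layer n y -> layer m (x + y);
    layer_scale : forall n, exists m, forall a x,
      segments n (a : R^o) -> layer n x -> layer m (a *: x)
  }.

Section CoherentSpan.
Variables (R : realType) (V : topologicalLmodType R).
Variable F : compact_filtration V.

Definition in_layers : {pred V} := fun v => `[< exists n, F n v >].

Lemma in_layersP v : reflect (exists n, F n v) (v \in in_layers).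
Proof. exact: asboolP. Qed.

Lemma layer_le m n : (m <= n)%N -> F m `<=` F n.
Proof.
by move=> mn; apply: increasing_seq_subset mn; exact: layer_increasing.
Qed.

Lemma in_layers_submod_closed : subsemimod_closed in_layers.
Proof.
split; first split.
- by apply/in_layersP; exact: layer_zero.
- move=> x y /in_layersP[m Fx] /in_layersP[n Fy]; apply/in_layersP.
  have [p Fp] := layer_add F (maxn m n); exists p; apply: Fp.
    by apply: layer_le Fx; exact: leq_maxl.
  by apply: layer_le Fy; exact: leq_maxr.
- move=> a x /in_layersP[m Fx]; apply/in_layersP.
  pose n := maxn m (Num.truncn `|a|).+1.
  have [p Fp] := layer_scale F n; exists p; apply: Fp.
    apply/segmentsE/ltW/(lt_le_trans (truncnS_gt _)).
    by rewrite ler_nat leq_maxr.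
  by apply: layer_le Fx; exact: leq_maxl.
Qed.

HB.instance Definition _ :=
  GRing.isSubmodClosed.Build R V in_layers in_layers_submod_closed.

(** A new carrier is needed because the layers need not exhaust [V], so that the
    coherent topology on [V] itself need not be a vector topology. *)
Record coherent_span :=
  CoherentSpan { span_val : V; span_valP : span_val \in in_layers }.

HB.instance Definition _ := [isSub for span_val].
HB.instance Definition _ := [Choice of coherent_span by <:].
HB.instance Definition _ := [SubChoice_isSubLmodule of coherent_span by <:].

Let span_open (U : set coherent_span) := coherent_open F (span_val @` U).

Let span_openT : span_open setT.
Proof.
move=> n; apply/open_subspaceP; exists setT; first exact: openT.
apply/seteqP; split=> v [_ Fv]; split=> //.
have vF : v \in in_layers by apply/in_layersP; exists n.
by exists (CoherentSpan vF).
Qed.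

Let span_openI : setI_closed span_open.
Proof.
move=> A B oA oB n.
have -> : span_val @` (A `&` B) = span_val @` A `&` span_val @` B.
  apply/seteqP; split=> [_ [w [Aw Bw] <-]|_ [[w Aw <-] [u Bu /val_inj uw]]].
    by split; exists w.
  by exists w => //; split=> //; rewrite -uw.
exact: openI.
Qed.

Let span_open_bigU (I : Type) (f : I -> set coherent_span) :
  (forall i, span_open (f i)) -> span_open (\bigcup_i f i).
Proof.
by move=> of_ n; rewrite image_bigcup; apply: bigcup_open => i _; exact: of_.
Qed.

HB.instance Definition _ := isOpenTopological.Build coherent_span
  span_openT span_openI span_open_bigU.

Lemma coherent_span_openE (U : set coherent_span) :
  open U = coherent_open F (span_val @` U).
Proof. by []. Qed.

Lemma open_coherent_span_preimage (U : set V) :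
  coherent_open F U -> open (span_val @^-1` U).
Proof.
rewrite coherent_span_openE => oU n.
apply/open_subspaceP; have /open_subspaceP[G oG GU] := oU n.
exists G => //; rewrite GU; apply/seteqP; split=> v [Uv Fv]; split=> //.
  have vF : v \in in_layers by apply/in_layersP; exists n.
  by exists (CoherentSpan vF).
by case: Uv => w Uw <-.
Qed.

Lemma span_val_continuous : continuous span_val.
Proof.
apply/continuousP => U oU.
exact/open_coherent_span_preimage/open_coherent_open.
Qed.

Lemma continuous_to_coherent_span (T : topologicalType)
    (f : T -> coherent_span) :
  (forall U, coherent_open F U -> open ((span_val \o f) @^-1` U)) ->
  continuous f.
Proof.
move=> fo; apply/continuousP => U; rewrite coherent_span_openE => /fo.
congr open; apply/seteqP; split=> t /=; last by exists (f t).
by move=> [w Uw /val_inj <-].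
Qed.

(** The common part of the continuity of addition and of scaling.  Through [p]
    and [q] the spaces [Y] and [Z] carry at least all open sets coherent with
    the compact layers of [T] and [S], so the box given by [coherent_open_box]
    pulls back to a neighbourhood in [Y * Z]. *)
Lemma coherent_span_binop_continuous (T S : topologicalType)
    (K : nat -> set T) (L : nat -> set S) (Y Z : topologicalType)
    (p : Y -> T) (q : Z -> S) (f : T * S -> V) (g : Y * Z -> coherent_span) :
  hausdorff_space T -> hausdorff_space S ->
  (forall n, compact (K n)) -> (forall n, compact (L n)) ->
  (forall n, K n `<=` K n.+1) -> (forall n, L n `<=` L n.+1) ->
  (forall y, exists n, K n (p y)) -> (forall z, exists n, L n (q z)) ->
  (forall U, coherent_open K U -> open (p @^-1` U)) ->
  (forall U, coherent_open L U -> open (q @^-1` U)) ->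
  continuous f ->
  (forall n, exists m, K n `*` L n `<=` f @^-1` F m) ->
  (forall x, span_val (g x) = f (p x.1, q x.2)) ->
  continuous g.
Proof.
move=> hT hS cK cL Kinc Linc Kp Lq po qo cf fF gE.
apply: continuous_to_coherent_span => U oU; rewrite openE => -[y z] /=.
rewrite gE /= => Uf.
have [k Kk] := Kp y; have [l Ll] := Lq z.
have pK : K (maxn k l) (p y).
  by apply: increasing_seq_subset Kk => //; exact: leq_maxl.
have qL : L (maxn k l) (q z).
  by apply: increasing_seq_subset Ll => //; exact: leq_maxr.
have ofU := coherent_open_preimage cf fF oU.
have [A [B [oA oB Aa Bb AB]]] :=
  coherent_open_box hT hS cK cL Kinc Linc ofU pK qL Uf.
exists (p @^-1` A, q @^-1` B).
  by split; apply: open_nbhs_nbhs; split=> //; [exact: po|exact: qo].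
by move=> [y' z'] [/= Ay Bz]; rewrite /preimage /= gE; exact: (AB (_, _)).
Qed.

Let hV : hausdorff_space V := ambient_hausdorff F.

Lemma coherent_span_hausdorff : hausdorff_space coherent_span.
Proof.
move=> p q clpq; apply: val_inj; apply: hV => A B Ap Bq.
have [||w [Aw Bw]] := clpq (span_val @^-1` A) (span_val @^-1` B).
- exact: span_val_continuous.
- exact: span_val_continuous.
- by exists (span_val w).
Qed.

Lemma coherent_span_in_layers (w : coherent_span) : exists n, F n (span_val w).
Proof. exact/in_layersP/span_valP. Qed.

Lemma coherent_span_add_continuous :
  continuous (fun x : coherent_span * coherent_span => x.1 + x.2).
Proof.
apply: (@coherent_span_binop_continuous V V F F _ _ span_val span_val
  (fun x => x.1 + x.2)) => //.
- exact: layer_compact.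
- exact: layer_compact.
- exact: layer_increasing.
- exact: layer_increasing.
- exact: coherent_span_in_layers.
- exact: coherent_span_in_layers.
- exact: open_coherent_span_preimage.
- exact: open_coherent_span_preimage.
- exact: add_continuous.
- move=> n; have [m Fm] := layer_add F n.
  by exists m => -[x y] [/= Fx Fy]; exact: Fm.
Qed.

Lemma coherent_span_scale_continuous :
  continuous (fun x : R^o * coherent_span => x.1 *: x.2).
Proof.
apply: (@coherent_span_binop_continuous R^o V (@segments R) F _ _ id span_val
  (fun x : R^o * V => x.1 *: x.2)) => //.
- by move=> n; exact: segment_compact.
- exact: layer_compact.
- move=> n a /segmentsE an; apply/segmentsE; apply: le_trans an _.
  by rewrite ler_nat.
- exact: layer_increasing.
- move=> a; exists (Num.truncn `|a|).+1; apply/segmentsE/ltW; exact: truncnS_gt.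
- exact: coherent_span_in_layers.
- exact: coherent_open_segments.
- exact: open_coherent_span_preimage.
- exact: scale_continuous.
- move=> n; have [m Fm] := layer_scale F n.
  by exists m => -[a x] [/= an Fx]; exact: Fm.
Qed.

HB.instance Definition _ :=
  PreTopologicalNmodule_isTopologicalNmodule.Build coherent_span
    coherent_span_add_continuous.
HB.instance Definition _ :=
  TopologicalNmodule_isTopologicalLmodule.Build R coherent_span
    coherent_span_scale_continuous.

End CoherentSpan.

(** * The filtration by bounded linear combinations *)

(** The sums of [k] vectors of [A] with coefficients in [[-c, c]].  Separating the
    bound from the number of terms, which coincide in [sp], is what allows an
    induction on [k]; writing a layer as a continuous image of a product makes
    its compactness immediate. *)
Fixpoint bounded_sums (R : realType) (V : lmodType R) (c : R) (A : set V)
    (k : nat) : set V :=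
  if k is k'.+1 then
    (fun p : V * (R^o * V) => p.1 + p.2.1 *: p.2.2) @`
      (bounded_sums c A k' `*` (`[- c, c]%classic `*` A))
  else [set 0].

Section BoundedSums.
Variables (R : realType) (V : lmodType R).
Implicit Types (c : R) (A : set V) (k : nat) (v : V).

Lemma bounded_sumsP c A k v : bounded_sums c A k v <->
  exists (l : 'I_k -> R) (x : 'I_k -> V),
    [/\ forall j, - c <= l j <= c, forall j, A (x j) & v = \sum_(j < k) l j *: x j].
Proof.
elim: k v => [|k IHk] v /=.
  split=> [->|[l [x [_ _ ->]]]]; last by rewrite big_ord0.
  by exists (fun=> 0), (fun=> 0); split=> [[]|[]|] //; rewrite big_ord0.
split=> [[[u [a y]] [/= /IHk[l [x [lc Ax ->]]] [/= ac Ay]] <-]|[l [x [lc Ax ->]]]].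
  exists (fun j => oapp l a (unlift ord0 j)), (fun j => oapp x y (unlift ord0 j)).
  split=> [j|j|].
  - by case: (unlift ord0 j) => [i|] /=; [exact: lc|rewrite in_itv in ac].
  - by case: (unlift ord0 j) => [i|] /=; [exact: Ax|].
  rewrite big_ord_recl unlift_none /= addrC; congr (_ + _).
  by apply: eq_bigr => j _; rewrite liftK.
rewrite big_ord_recl addrC.
exists (\sum_(j < k) l (lift ord0 j) *: x (lift ord0 j), (l ord0, x ord0)) => //.
split=> /=; last by rewrite in_itv /=.
by apply/IHk; exists (l \o lift ord0), (x \o lift ord0); split=> [j|j|] /=.
Qed.

Lemma bounded_sums_add c A k l u v :
  bounded_sums c A k u -> bounded_sums c A l v -> bounded_sums c A (k + l) (u + v).
Proof.
move=> ku; elim: l v => [|l IHl] v /=; first by move=> ->; rewrite addn0 addr0.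
move=> [[w [a x]] [/= /IHl lw ax] <-]; rewrite addnS addrA.
by exists (u + w, (a, x)).
Qed.

Lemma bounded_sums_scale c d A k a v : `|a| <= d ->
  bounded_sums c A k v -> bounded_sums (d * c) A k (a *: v).
Proof.
move=> ad; elim: k v => [|k IHk] v /=; first by move=> ->; rewrite scaler0.
move=> [[w [b x]] [/= /IHk kw [/= bc Ax]] <-].
exists (a *: w, (a * b, x)); last by rewrite scalerDr scalerA.
split=> //; split=> //=; move: bc; rewrite !in_itv /= -!ler_norml normrM => bc.
by apply: ler_pM.
Qed.

(** Longer sums are obtained by padding with zero coefficients, for which [A'] has
    to be nonempty; this is what [0 < k] gives when the smaller set has an
    element. *)
Lemma bounded_sums_le c c' A A' k k' : 0 <= c' -> c <= c' -> A `<=` A' ->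
  (0 < k <= k')%N -> bounded_sums c A k `<=` bounded_sums c' A' k'.
Proof.
move=> c'0 cc' AA' /andP[k0 kk'].
apply: (@subset_trans _ (bounded_sums c' A' k)).
  elim: k {k0 kk'} => //= k IHk v [[w [a x]] [/= /IHk kw [/= ac Ax]] <-].
  exists (w, (a, x)) => //; split=> //; split=> /=; last exact: AA'.
  move: ac; rewrite !in_itv /= -!ler_norml => ac; exact: le_trans cc'.
case: k k0 kk' => // k _ kk' v kv.
have [x A'x] : A' !=set0 by case: kv => -[w [a x]] [_ [_ /= A'x]] _; exists x.
elim: k' kk' => // k' IHk'; rewrite leq_eqVlt => /orP[/eqP <- //|/IHk' k'v].
exists (v, (0, x)); last by rewrite /= scale0r addr0.
by split=> //; split=> //=; rewrite in_itv /= oppr_le0 c'0.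
Qed.

End BoundedSums.

Lemma bounded_sums_compact (R : realType) (V : topologicalLmodType R) (c : R)
    (A : set V) (k : nat) : compact A -> compact (bounded_sums c A k).
Proof.
move=> cA; elim: k => [|k IHk] /=; first exact: compact_set1.
apply: continuous_compact; last first.
  apply: compact_setX => //; apply: compact_setX => //; exact: segment_compact.
apply: continuous_subspaceT => p.
apply: (@continuous_comp _ _ _
  (fun p : V * (R^o * V) => (p.1, p.2.1 *: p.2.2)) (fun q => q.1 + q.2)).
  apply: cvg_pair => /=; first exact: cvg_fst.
  apply: (@continuous_comp _ _ _ snd (fun q : R^o * V => q.1 *: q.2)).
    exact: cvg_snd.
  exact: scale_continuous.
exact: add_continuous.
Qed.

Lemma spE (R : realType) (V : lmodType R) (n : nat) (A : set V) :
  sp n A = bounded_sums n%:R A n.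
Proof. by apply/seteqP; split=> v /bounded_sumsP. Qed.

Section SpFiltration.
Variables (R : realType) (V : topologicalLmodType R) (A : nat -> set V).
Hypothesis hV : hausdorff_space V.
Hypothesis A_compact : forall n, compact (A n).
Hypothesis A_increasing : forall n, A n `<=` A n.+1.
Hypothesis A_nonempty : exists n, A n !=set0.

Let L n := sp n.+1 (A n).

Lemma sp_layer_compact n : compact (L n).
Proof. by rewrite /L spE; exact: bounded_sums_compact. Qed.

Lemma sp_layer_increasing n : L n `<=` L n.+1.
Proof.
rewrite /L !spE; apply: bounded_sums_le => //; last by rewrite ltnS leqnSn.
by rewrite ler_nat.
Qed.

Lemma sub_sp_layer n : A n `<=` L n.
Proof.
move=> x Ax; rewrite /L spE.
apply: (@bounded_sums_le _ _ 1 _ (A n) _ 1) => //; first by rewrite ler1n.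
exists (0, (1, x)); last by rewrite /= add0r scale1r.
split=> //; split=> //=; rewrite in_itv /= lexx andbT.
by apply: (@le_trans _ _ 0); rewrite ?oppr_le0.
Qed.

Lemma sp_layer_add n : exists m, forall x y, L n x -> L n y -> L m (x + y).
Proof.
exists (n + n.+1)%N => x y; rewrite /L !spE => Lx Ly.
apply: bounded_sums_le (bounded_sums_add Lx Ly) => //.
- by rewrite ler_nat; apply: leqW; exact: leq_addl.
- by apply: increasing_seq_subset => //; exact: leq_addr.
- by rewrite addSn /= leqnn.
Qed.

Lemma sp_layer_scale n : exists m, forall a x,
  segments n (a : R^o) -> L n x -> L m (a *: x).
Proof.
(* [n * n.+1] bounds the new coefficients; adding [n] keeps [n.+1] terms and
   the vectors of [A n] available. *)
exists (n + n * n.+1)%N => a x /segmentsE an; rewrite /L !spE => Lx.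
apply: bounded_sums_le (bounded_sums_scale an Lx) => //.
- by rewrite -natrM ler_nat; apply: leqW; exact: leq_addl.
- by apply: increasing_seq_subset => //; exact: leq_addr.
- by rewrite /= ltnS leq_addr.
Qed.

Lemma sp_layer_zero : exists n, L n 0.
Proof.
have [n [x Ax]] := A_nonempty; have [m Lm] := sp_layer_scale n.
exists m; rewrite -(scale0r x); apply: Lm; last exact: sub_sp_layer.
by apply/segmentsE; rewrite normr0.
Qed.

Definition sp_filtration : compact_filtration V :=
  CompactFiltration hV sp_layer_compact sp_layer_increasing sp_layer_zero
    sp_layer_add sp_layer_scale.

End SpFiltration.

(** * Free topological vector spaces over k_omega spaces *)

Theorem theorem3p1 (R : realType) (X : topologicalType)
    (V : topologicalLmodType R) (i : X -> V) (C : nat -> set X)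
    (X_nonempty : [set: X] !=set0)
    (X_tychonoff : tychonoff_space X)
    (C_decomposition : k_omega_decomposition C)
    (V_free : is_free_tvs i) :
  k_omega_space V /\
  k_omega_decomposition (fun n : nat => sp n.+1 (i @` C n)).
Proof.
suff dec : k_omega_decomposition (fun n : nat => sp n.+1 (i @` C n)).
  by split=> //; exists (fun n : nat => sp n.+1 (i @` C n)).
have [C_compact C_increasing C_cover C_open] := C_decomposition.
have [hV ci i_universal] := V_free.
have iC_compact n : compact (i @` C n).
  by apply: continuous_compact => //; exact: continuous_subspaceT.
have iC_increasing n : i @` C n `<=` i @` C n.+1.
  exact: image_subset.
have C_covers x : exists n, C n x.
  have : (\bigcup_n C n) x by rewrite C_cover.
  by move=> [n _ Cx]; exists n.
have iC_nonempty : exists n, (i @` C n) !=set0.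
  have [x _] := X_nonempty; have [n Cx] := C_covers x.
  by exists n, (i x); exists x.
pose F := sp_filtration hV iC_compact iC_increasing iC_nonempty.
have iF n x : C n x -> F n (i x).
  by move=> Cx; apply: sub_sp_layer; exists x.
have i_span x : i x \in in_layers F.
  by apply/in_layersP; have [n Cx] := C_covers x; exists n; exact: iF.
pose j x := CoherentSpan (i_span x).
have cj : continuous j.
  apply: continuous_to_coherent_span => U oU; apply/C_open => n.
  rewrite open_subspaceIT.
  by apply: (coherent_open_preimage ci) oU n => n; exists n => x; exact: iF.
(* Extending [j] along [i] and comparing with the identity of [V], the unique
   extension of [i], shows that [g] inverts the inclusion of the span. *)
have [g [[g_lin cg gi] _]] :=
  i_universal _ j (coherent_span_hausdorff (F := F)) cj.
have [h [_ h_uniq]] := i_universal V i hV ci.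
have gK v : span_val (g v) = v.
  have hE : h = @span_val _ _ F \o g.
    apply: h_uniq; split.
    - by move=> a u w /=; rewrite g_lin.
    - move=> u; apply: continuous_comp; [exact: cg|exact: span_val_continuous].
    - by apply/funext => x; rewrite /= -[g (i x)]/((g \o i) x) -gi.
  have hid : h = id by apply: h_uniq; split=> //; move=> u; exact: cvg_id.
  by rewrite -[LHS]/((@span_val _ _ F \o g) v) -hE hid.
split.
- exact: layer_compact F.
- exact: layer_increasing F.
- apply/seteqP; split=> // v _; rewrite -(gK v).
  by have [n Fn] := coherent_span_in_layers (g v); exists n.
- move=> U; split=> [oU n|oU].
    by rewrite open_subspaceIT; exact: (@open_coherent_open _ F U oU n).
  have oFU : coherent_open F U by move=> n; rewrite -open_subspaceIT; exact: oU.
  have := open_coherent_span_preimage oFU.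
  move/continuousP: cg => /[apply]; congr open.
  by apply/seteqP; split=> v /=; rewrite gK.
Qed.
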